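(* Let $\mathfrak{G}$ be a singular transmissible parameter. For every non-discrete metrizable space $X$, the set of all $d\in \mathrm{Met}(X)$ for which $(X,d)$ satisfies the anti-$\mathfrak{G}$-transmissible property is a dense $G_\delta$ subset of $\mathrm{Met}(X)$.
   Context: For a metrizable space $X$, $\mathrm{Met}(X)$ denotes the set of all metrics on $X$ generating the topology of $X$, equipped with the topology generated by the $[0,\infty]$-valued metric $\mathcal{D}_X(d,e)=\sup_{(x,y)\in X^2}|d(x,y)-e(x,y)|$. Let $\mathbb{N}$ be the set of positive integers, $\mathcal{P}^*(\mathbb{N})$ the set of all non-empty subsets of $\mathbb{N}$, and for a topological space $T$ let $\mathcal{F}(T)$ be the set of all closed subsets of $T$. For $W\in\mathcal{P}^*(\mathbb{N})$ and a set $S$, $\mathrm{Seq}(W,S)$ is the set of all finite injective sequences $\{a_i\}_{i=1}^n$ in $S$ with $n\in W$. Transmissible parameter: a sextuple $\mathfrak{G}=(Q,P,F,G,Z,\phi)$ where $Q$ is an at most countable set, $P$ is a topological space, $F:Q\to\mathcal{F}(P)$ and $G:Q\to\mathcal{P}^*(\mathbb{N})$ are maps, $Z$ is a set, and $\phi$ assigns to each pair $(q,X)$ of $q\in Q$ and a metrizable space $X$ a map $\phi^{q,X}:\mathrm{Seq}(G(q),X)\times Z\times\mathrm{Met}(X)\to P$, such that for every metrizable space $X$, every $q\in Q$ and every $z\in Z$: (TP1) for every $a\in\mathrm{Seq}(G(q),X)$ the map $\mathrm{Met}(X)\to P$, $d\mapsto\phi^{q,X}(a,z,d)$, is continuous;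 (TP2) for every $d\in\mathrm{Met}(X)$, if $S\subset X$ and $a\in\mathrm{Seq}(G(q),S)$, then $\phi^{q,X}(a,z,d)=\phi^{q,S}(a,z,d|_{S^2})$. A metric space $(X,d)$ satisfies the $\mathfrak{G}$-transmissible property if there exists $q\in Q$ such that $\phi^{q,X}(a,z,d)\in F(q)$ for all $a\in\mathrm{Seq}(G(q),X)$ and $z\in Z$. It satisfies the anti-$\mathfrak{G}$-transmissible property if this fails, i.e. for every $q\in Q$ there exist $a\in\mathrm{Seq}(G(q),X)$ and $z\in Z$ with $\phi^{q,X}(a,z,d)\in P\setminus F(q)$. $\mathfrak{G}$ is singular if for each $q\in Q$ and every $\epsilon\in(0,\infty)$ there exist $z\in Z$ and a finite metric space $(L,d_L)$ such that (1) the diameter of $(L,d_L)$ is at most $\epsilon$; (2) $\mathrm{card}(L)\in G(q)$; (3) $\phi^{q,L}(L,z,d_L)\in P\setminus F(q)$, where $L$ in the first argument means the points of $L$ arranged in some injective sequence of length $\mathrm{card}(L)$.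
   Formalization: (TP2) is assumed for every topological embedding of S into X, not just for subsets S of X, so φ is invariant under isometries; with literal subsets the claim fails, e.g. for φ that only detects one fixed two-point set disjoint from X. *)

(* Defs.v *)
From HB Require Import structures.
From mathcomp Require Import all_boot all_order all_algebra finmap.
From mathcomp Require Import all_classical all_reals all_analysis.

Set Implicit Arguments.
Unset Strict Implicit.
Unset Printing Implicit Defensive.

Import Order.TTheory GRing.Theory Num.Theory.
Import numFieldNormedType.Exports.

Local Open Scope classical_set_scope.
Local Open Scope ring_scope.

Record Met (R : realType) (X : topologicalType) := MkMet {
  met_fun :> X -> X -> R ;
  met_xx : forall x, met_fun x x = 0 ;
  met_eq0 : forall x y, met_fun x y = 0 -> x = y ;
  met_sym : forall x y, met_fun x y = met_fun y x ;
  met_triangle : forall x y z, met_fun x z <= met_fun x y + met_fun y z ;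
  met_open : forall A : set X,
    open A <-> forall x, A x ->
      exists2 r : R, 0 < r & [set y | met_fun x y < r] `<=` A }.

Arguments Met : clear implicits.

Definition metrizable (R : realType) (X : topologicalType) : Prop :=
  inhabited (Met R X).

Definition discrete_space (X : topologicalType) : Prop :=
  forall A : set X, open A.

(* The supremum is taken in [0, +oo]: the [maxe 0] only matters for empty X,
   where [ereal_sup set0 = -oo]. *)
Definition dist_Met (R : realType) (X : topologicalType) (d e : Met R X) :
    \bar R :=
  maxe 0%E (ereal_sup
    [set (`|d p.1 p.2 - e p.1 p.2|)%:E | p in [set: X * X]]).

Definition ball_Met (R : realType) (X : topologicalType)
    (d : Met R X) (r : R) : set (Met R X) :=
  [set e | (dist_Met d e < r%:E)%E].

Section MetTopology.
Context {R : realType} {X : topologicalType}.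

Lemma dist_Met_ge0 (d e : Met R X) : (0 <= dist_Met d e)%E.
Proof. by rewrite /dist_Met le_max lexx. Qed.

Lemma dist_Met_ub (d e : Met R X) x y :
  ((`|d x y - e x y|)%:E <= dist_Met d e)%E.
Proof.
rewrite /dist_Met le_max; apply/orP; right.
by apply: ereal_sup_ubound; exists (x, y).
Qed.

Lemma dist_Met_le (d e : Met R X) (c : \bar R) : (0 <= c)%E ->
  (forall x y, ((`|d x y - e x y|)%:E <= c)%E) -> (dist_Met d e <= c)%E.
Proof.
move=> c0 H; rewrite /dist_Met ge_max c0 /=.
by apply: ge_ereal_sup => _ [[x y] _ <-]; exact: H.
Qed.

Lemma ball_Met_center (d : Met R X) (r : R) : 0 < r -> ball_Met d r d.
Proof.
move=> r0; rewrite /ball_Met /=.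
apply: (@le_lt_trans _ _ 0%E); last by rewrite lte_fin.
by apply: dist_Met_le => // x y; rewrite subrr normr0.
Qed.

Lemma ball_Met_sym (d e : Met R X) (r : R) : ball_Met d r e -> ball_Met e r d.
Proof.
rewrite /ball_Met /=; apply: le_lt_trans; apply: dist_Met_le.
  exact: dist_Met_ge0.
by move=> x y; rewrite distrC; exact: dist_Met_ub.
Qed.

Lemma ball_Met_triangle (d e f : Met R X) (r s : R) :
  ball_Met d r e -> ball_Met e s f -> ball_Met d (r + s) f.
Proof.
rewrite /ball_Met /= => de ef.
apply: (@le_lt_trans _ _ (dist_Met d e + dist_Met e f)%E); last first.
  by rewrite EFinD; exact: lteD.
apply: dist_Met_le; first by rewrite adde_ge0// dist_Met_ge0.
move=> x y.
apply: (@le_trans _ _ ((`|d x y - e x y|)%:E + (`|e x y - f x y|)%:E)%E).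
  by rewrite -EFinD lee_fin; exact: ler_distD.
by apply: leeD; exact: dist_Met_ub.
Qed.

HB.instance Definition _ := gen_eqMixin (Met R X).
HB.instance Definition _ := gen_choiceMixin (Met R X).
HB.instance Definition _ :=
  hasNbhs.Build (Met R X) (nbhs_ (entourage_ (@ball_Met R X))).
HB.instance Definition _ :=
  @Nbhs_isPseudoMetric.Build R (Met R X) (entourage_ (@ball_Met R X)) erefl
    (@ball_Met R X) ball_Met_center ball_Met_sym ball_Met_triangle erefl.

End MetTopology.

Record Seq (W : set nat) (S : eqType) := MkSeq {
  seq_val :> seq S ;
  seq_uniq : uniq seq_val ;
  seq_size : W (size seq_val) }.

(* A subset S of X, with the subspace topology, is given by a type S together
   with a topological embedding into X; [set_val : S -> X] is one for each
   S : set X. *)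
Record embedding (S X : topologicalType) := MkEmbedding {
  emb_fun :> S -> X ;
  emb_inj : injective emb_fun ;
  emb_open : forall U : set S,
    open U <-> exists2 V : set X, open V & U = emb_fun @^-1` V }.

Section Restriction.
Context {S X : topologicalType} (i : embedding S X).

Lemma seq_incl_uniq (W : set nat) (a : Seq W S) : uniq (map i a).
Proof. by rewrite (map_inj_uniq (@emb_inj _ _ i)); exact: seq_uniq. Qed.

Lemma seq_incl_size (W : set nat) (a : Seq W S) : W (size (map i a)).
Proof. by rewrite size_map; exact: seq_size. Qed.

Definition seq_incl (W : set nat) (a : Seq W S) : Seq W X :=
  MkSeq (seq_incl_uniq a) (seq_incl_size a).

Context {R : realType}.

Lemma met_restr_open (d : Met R X) (A : set S) :
  open A <-> forall x, A x ->
    exists2 r : R, 0 < r & [set y | d (i x) (i y) < r] `<=` A.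
Proof.
split=> [/(emb_open i)[V /(met_open d) oV ->] x Vx|H].
  by have [r r0 rV] := oV _ Vx; exists r => // y; exact: rV.
apply/(emb_open i).
pose V := [set x : X | exists2 r : R, 0 < r &
  exists2 s : R, 0 < s & forall u (y : S), d x u < s -> d u (i y) < r -> A y].
exists V.
  apply/(met_open d) => x [r r0 [s s0 H']].
  exists (s / 2); first by rewrite divr_gt0.
  move=> u /= xu; exists r => //; exists (s / 2); first by rewrite divr_gt0.
  move=> v y uv; apply: H'; apply: le_lt_trans (met_triangle d x u v) _.
  by rewrite [s]splitr ltrD.
apply/seteqP; split=> x /=.
  move=> /H[r r0 rA]; exists (r / 2); first by rewrite divr_gt0.
  exists (r / 2); first by rewrite divr_gt0.
  move=> u y xu uy; apply: rA => /=.
  apply: le_lt_trans (met_triangle d (i x) u (i y)) _.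
  by rewrite [r]splitr ltrD.
by move=> [r r0 [s s0]] /(_ (i x) x); rewrite met_xx; exact.
Qed.

Definition met_restr (d : Met R X) : Met R S :=
  @MkMet R S (fun x y => d (i x) (i y))
    (fun x => met_xx d (i x))
    (fun x y h => emb_inj (met_eq0 h))
    (fun x y => met_sym d (i x) (i y))
    (fun x y z => met_triangle d (i x) (i y) (i z))
    (met_restr_open d).

End Restriction.

(* [Met R X] is empty when X is not metrizable, so [tp_phi q X] carries
   information for metrizable X only.  In [tp_TP2], quantifying over embeddings
   rather than over [set X] makes [tp_phi] invariant under isometries, as is
   implicit when a finite metric space is viewed as a subspace of another
   space; it also makes [tp_phi] independent of the choice operator bundled in
   a [topologicalType]. *)
Record transmissible_parameter (R : realType) := TransmissibleParameter {
  tp_Q : Type ;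
  tp_P : topologicalType ;
  tp_F : tp_Q -> set tp_P ;
  tp_G : tp_Q -> set nat ;
  tp_Z : Type ;
  tp_phi : forall (q : tp_Q) (X : topologicalType),
    Seq (tp_G q) X -> tp_Z -> Met R X -> tp_P ;
  tp_Q_countable : countable [set: tp_Q] ;
  tp_F_closed : forall q, closed (tp_F q) ;
  tp_G_neq0 : forall q, tp_G q !=set0 ;
  tp_G_gt0 : forall q n, tp_G q n -> (0 < n)%N ;
  tp_TP1 : forall (X : topologicalType) (q : tp_Q) (z : tp_Z)
    (a : Seq (tp_G q) X), continuous (tp_phi a z : Met R X -> tp_P) ;
  tp_TP2 : forall (X : topologicalType) (q : tp_Q) (z : tp_Z) (d : Met R X)
    (S : topologicalType) (i : embedding S X) (a : Seq (tp_G q) S),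
    tp_phi (seq_incl i a) z d = tp_phi a z (met_restr i d) }.

Definition transmissible_property (R : realType)
    (G : transmissible_parameter R) (X : topologicalType) (d : Met R X) : Prop :=
  exists q : tp_Q G, forall (a : Seq (tp_G q) X) (z : tp_Z G),
    tp_F q (tp_phi a z d).

Definition anti_transmissible_property (R : realType)
    (G : transmissible_parameter R) (X : topologicalType) (d : Met R X) : Prop :=
  ~ transmissible_property G d.

Definition diameter (R : realType) (X : topologicalType) (d : Met R X) :
    \bar R :=
  ereal_sup [set (d p.1 p.2)%:E | p in [set: X * X]].

Definition singular (R : realType) (G : transmissible_parameter R) : Prop :=
  forall (q : tp_Q G) (eps : R), 0 < eps ->
  exists (z : tp_Z G) (L : topologicalType) (dL : Met R L),
    [/\ finite_set [set: L],
        (diameter dL <= eps%:E)%E,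
        tp_G q #|` fset_set [set: L]| &
        exists2 a : Seq (tp_G q) L, size a = #|` fset_set [set: L]| &
          ~ tp_F q (tp_phi a z dL)].

(* Main.v *)
Require Import Defs.
From mathcomp Require Import all_boot all_order all_algebra finmap.
From mathcomp Require Import all_classical all_reals all_analysis borel_hierarchy.
From mathcomp Require Import lra.

Set Implicit Arguments.
Unset Strict Implicit.
Unset Printing Implicit Defensive.

Import Order.TTheory GRing.Theory Num.Theory.

Local Open Scope classical_set_scope.
Local Open Scope ring_scope.

(** The G_delta half is formal: for fixed q, a and z, the metrics d with
    phi(a, z, d) outside the closed set F(q) form an open set by (TP1); the
    anti-transmissible metrics are the intersection over the countably many q
    of the unions over (a, z) of these sets ([anti_transmissible_Gdelta]).

    For density, no Baire category argument is made: one perturbation of a given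
    metric d defeats all q at once.  Singularity supplies, for each q, a finite
    metric space L_q of diameter at most c / (n_q + 1), where q |-> n_q is an
    injection into the naturals, that is a witness against q.  By (TP2) it is
    enough to find a metric e within c of d such that every L_q embeds
    isometrically in (X, e) ([simultaneous_isometries]).

    Let p be a non-isolated point of X.  Place the points of all the L_q at
    distinct points of X so close to p that, on the copy of L_q, d is smaller
    than the least positive distance of L_q.  The Frechet embedding
    u |-> (d_{L_q}(l, u))_l of L_q into a sup-normed space then suggests the
    metric
      e(x, y) = max (d(x, y), sup_{q, l} |f_{q,l}(x) - f_{q,l}(y)|)
    where f_{q,l} : X -> [0, c / (n_q + 1)] is continuous, equals d_{L_q}(l, .)
    on the copy of L_q, and vanishes on the copies of the other spaces.  On the
    copy of L_q both d and the functions of index other than q contribute at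
    most d_{L_q}, so e agrees with d_{L_q} there; and d <= e <= d + c
    everywhere.  Because the heights c / (n_q + 1) tend to 0, the f_{q,l} are
    equicontinuous, which is what makes e generate the topology of X
    ([sup_perturbation]).

    The f_{q,l} are combinations of Lipschitz bumps h_k with
    h_k(x_j) = 1 if j = k and 0 otherwise.  To get these, the points x_k are
    chosen so that the distances d(p, x_k) at least halve at each step; h_k can
    then be a function of the distance to p alone ([separating_bumps]). *)

(** * Metrics generating a given topology *)

Section Perturbation.
Context {R : realType}.

Lemma met_ge0 (X : topologicalType) (d : Met R X) x y : 0 <= d x y.
Proof.
have := met_triangle d x y x; rewrite met_xx (met_sym d y x); lra.
Qed.

Lemma met_gt0 (X : topologicalType) (d : Met R X) x y : x <> y -> 0 < d x y.
Proof.
by move=> xy; rewrite lt_neqAle met_ge0 andbT; apply/eqP => /esym/met_eq0.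
Qed.

Lemma Met_ext (X : topologicalType) (d e : Met R X) :
  (forall x y, d x y = e x y) -> d = e.
Proof.
case: d e => [d a1 a2 a3 a4 a5] [e b1 b2 b3 b4 b5] /= de.
have {}de : d = e by apply/funext => x; apply/funext.
by subst e; f_equal; exact: Prop_irrelevance.
Qed.

Lemma ball_open (X : topologicalType) (d : Met R X) x r :
  open [set y | d x y < r].
Proof.
apply/(met_open d) => y /= xy; exists (r - d x y); first lra.
by move=> z /= yz; have := met_triangle d x y z; lra.
Qed.

(** Since both topologies come from the metrics, a map preserving distances is
    automatically a topological embedding; this is how copies of finite metric
    spaces become arguments to which (TP2) applies. *)
Lemma isometry_embedding (S X : topologicalType) (dS : Met R S) (d : Met R X)
    (i : S -> X) : (forall u v, d (i u) (i v) = dS u v) ->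
  exists j : embedding S X, j =1 i /\ met_restr j d = dS.
Proof.
move=> iE.
have inj : injective i.
  by move=> u v uv; apply: (@met_eq0 _ _ dS); rewrite -iE uv met_xx.
have emb (U : set S) :
    open U <-> exists2 V : set X, open V & U = i @^-1` V.
  split=> [/(met_open dS) oU|[V /(met_open d) oV ->]].
    exists (\bigcup_(p in [set p : S * R | [set v | dS p.1 v < p.2] `<=` U])
              [set y | d (i p.1) y < p.2]).
      by apply: bigcup_open => p _; exact: ball_open.
    apply/seteqP; split=> [u /oU[r r0 rU]|u [[v r] /= vU]].
      by exists (u, r) => //=; rewrite met_xx.
    by rewrite iE; exact: vU.
  apply/(met_open dS) => u /oV[r r0 rV]; exists r => // v /= uv.
  by apply: rV => /=; rewrite iE.
exists (MkEmbedding inj emb); split => //.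
exact: Met_ext.
Qed.

Lemma nonisolated_point (X : topologicalType) (d : Met R X) :
  ~ discrete_space X ->
  exists p, forall r, 0 < r -> exists y, 0 < d p y < r.
Proof.
move=> /existsNP[A nA]; apply: contrapT => /forallNP iso; apply: nA.
apply/(met_open d) => x Ax.
have /existsNP[r /not_implyP[r0 /forallNP rP]] := iso x.
exists r => // y /= xy; have [<-//|/met_gt0 -/(_ d) d0] := pselect (x = y).
by have := rP y; rewrite d0 xy.
Qed.

(** * Perturbing a metric by an equicontinuous family of functions *)

(** The new metric is the supremum of d and of the pseudometrics |f x - f y|.
    It is at least d, so its topology is at least as fine; equicontinuity makes
    it continuous for d, so its topology is no finer. *)
Lemma sup_perturbation (X : topologicalType) (d : Met R X)
    (Phi : set (X -> R)) (c : R) :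
  0 <= c ->
  (forall f, Phi f -> forall x y, `|f x - f y| <= c) ->
  (forall x eps, 0 < eps -> exists2 r, 0 < r &
    forall f, Phi f -> forall y, d x y < r -> `|f x - f y| <= eps) ->
  exists e : Met R X, [/\ (dist_Met d e <= c%:E)%E,
    forall f, Phi f -> forall x y, `|f x - f y| <= e x y &
    forall x y b, d x y <= b -> (forall f, Phi f -> `|f x - f y| <= b) ->
      e x y <= b].
Proof.
move=> c0 Phic equi.
(* The value d x y belongs to the set, so that the supremum is taken over a
   nonempty set even if the family is empty. *)
pose gaps x y := [set d x y] `|` [set `|f x - f y| | f in Phi].
pose e x y := sup (gaps x y).
have e_le x y b : d x y <= b -> (forall f, Phi f -> `|f x - f y| <= b) ->
    e x y <= b.
  move=> db fb; apply: ge_sup; first by exists (d x y); left.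
  by move=> _ [->//|[f /fb + <-]].
have ub x y : has_ubound (gaps x y).
  exists (d x y + c) => _ [->|[f /Phic /(_ x y) fc <-]]; first lra.
  by have := met_ge0 d x y; lra.
have d_le x y : d x y <= e x y by apply: ub_le_sup => //; left.
have f_le f x y : Phi f -> `|f x - f y| <= e x y.
  by move=> Pf; apply: ub_le_sup => //; right; exists f.
have exx x : e x x = 0.
  apply/eqP; rewrite eq_le; apply/andP; split.
    by apply: e_le => [|f _]; rewrite ?met_xx// subrr normr0.
  by rewrite -(met_xx d x).
have esym x y : e x y = e y x.
  apply/eqP; rewrite eq_le; apply/andP; split; apply: e_le.
  - by rewrite met_sym.
  - by move=> f Pf; rewrite distrC; exact: f_le.
  - by rewrite met_sym.
  - by move=> f Pf; rewrite distrC; exact: f_le.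
have e0 x y : e x y = 0 -> x = y.
  move=> exy; apply: (@met_eq0 _ _ d); apply/eqP.
  by rewrite eq_le met_ge0 andbT -exy.
have etri x y z : e x z <= e x y + e y z.
  apply: e_le => [|f Pf].
    by apply: le_trans (met_triangle d x y z) _; exact: lerD.
  by apply: le_trans (ler_distD (f y) _ _) _; apply: lerD; exact: f_le.
have eopen (A : set X) : open A <-> forall x, A x ->
    exists2 r : R, 0 < r & [set y | e x y < r] `<=` A.
  split=> [/(met_open d) oA x /oA[r r0 rA]|eA].
    by exists r => // y /= exy; apply: rA; exact: le_lt_trans exy.
  apply/(met_open d) => x /eA[r r0 rA].
  have r20 : 0 < r / 2 by lra.
  have [s s0 sP] := equi x _ r20.
  exists (Num.min s (r / 2)); first by rewrite lt_min s0.
  move=> y /=; rewrite lt_min => /andP[ds dr]; apply: rA => /=.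
  apply: (@le_lt_trans _ _ (r / 2)); last lra.
  by apply: e_le => [|f Pf]; [exact: ltW|exact: sP].
exists (MkMet exx e0 esym etri eopen); split => // [|f Pf x y]; last exact: f_le.
apply: dist_Met_le => // x y; rewrite lee_fin /= distrC ger0_norm ?subr_ge0//.
rewrite lerBlDl; apply: e_le; first lra.
by move=> f Pf; have := Phic _ Pf x y; have := met_ge0 d x y; lra.
Qed.

(** * Separated points accumulating at a point *)

Lemma max0_lipschitz (a b : R) : `|Num.max 0 a - Num.max 0 b| <= `|a - b|.
Proof.
have := ler_norm (a - b); have := ler_norm (b - a); rewrite (distrC b a).
by move=> h1 h2; rewrite ler_norml; case: (leP 0 a); case: (leP 0 b); lra.
Qed.

Lemma min_lipschitz (c a b : R) : `|Num.min c a - Num.min c b| <= `|a - b|.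
Proof.
have := ler_norm (a - b); have := ler_norm (b - a); rewrite (distrC b a).
by move=> h1 h2; rewrite ler_norml; case: (leP c a); case: (leP c b); lra.
Qed.

Lemma met_lipschitz (X : topologicalType) (d : Met R X) p u v :
  `|d p u - d p v| <= d u v.
Proof.
have := met_triangle d p u v; have := met_triangle d p v u.
by rewrite (met_sym d v u) ler_norml; lra.
Qed.

(** With t_k = d(p, x_k) and t_{k+1} < t_k / 2, any other t_j is at distance at
    least t_k / 2 from t_k.  Hence h_k can be the tent function of slope 2 / t_k
    around t_k, composed with the (1-Lipschitz) distance to p. *)
Lemma separating_bumps (X : topologicalType) (d : Met R X) (p : X)
    (s : nat -> R) :
  (forall r, 0 < r -> exists y, 0 < d p y < r) -> (forall k, 0 < s k) ->
  exists (x : nat -> X) (h : nat -> X -> R) (C : nat -> R),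
    [/\ forall k, d p (x k) < s k,
        forall k u, 0 <= h k u,
        forall j k, h k (x j) = (j == k)%:R &
        forall k u v, `|h k u - h k v| <= C k * d u v].
Proof.
move=> acc s0.
have /choice[g gP] : forall r, exists y, 0 < r -> 0 < d p y < r.
  move=> r; case: (ltP 0 r) => [/acc[y]|r0]; first by exists y.
  by exists p.
pose x := fix x k := if k is m.+1 then g (Num.min (s k) (d p (x m) / 2))
                     else g (s 0).
have xP k : 0 < d p (x k) < s k.
  elim: k => [|k /andP[IH _]]; first exact: gP.
  have /gP/andP[h0] : 0 < Num.min (s k.+1) (d p (x k) / 2).
    by rewrite lt_min s0 divr_gt0.
  by rewrite lt_min => /andP[h1 _]; apply/andP.
have xS k : d p (x k.+1) < d p (x k) / 2.
  have /andP[t0 _] := xP k.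
  have /gP/andP[_] : 0 < Num.min (s k.+1) (d p (x k) / 2).
    by rewrite lt_min s0 divr_gt0.
  by rewrite lt_min => /andP[].
have xlt j k : (j < k)%N -> d p (x k) < d p (x j) / 2.
  elim: k => // k IH; rewrite ltnS leq_eqVlt => /orP[/eqP->//|/IH jk].
  by have := xS k; have /andP[] := xP j; lra.
pose h k u := Num.max 0 (1 - 2 / d p (x k) * `|d p u - d p (x k)|).
exists x, h, (fun k => 2 / d p (x k)); split => [k|k u|j k|k u v].
- by have /andP[] := xP k.
- by rewrite le_max lexx.
- have /andP[tk _] := xP k; have /andP[tj _] := xP j; rewrite /h.
  have [->|jk] := eqVneq j k.
    by rewrite subrr normr0 mulr0 subr0; apply/max_idPr.
  apply/max_idPl; rewrite subr_le0 mulrAC ler_pdivlMr// mul1r.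
  move: jk; rewrite neq_ltn => /orP[/xlt jk|/xlt jk].
    by rewrite ger0_norm; lra.
  by rewrite ler0_norm; lra.
- have /andP[tk _] := xP k; apply: le_trans (max0_lipschitz _ _) _.
  have -> (a b c : R) : 1 - c * a - (1 - c * b) = c * (b - a) by lra.
  rewrite normrM gtr0_norm ?divr_gt0// ler_pM2l ?divr_gt0//.
  apply: le_trans (ler_dist_dist _ _) _.
  have -> : d p v - d p (x k) - (d p u - d p (x k)) = d p v - d p u by lra.
  by rewrite (met_sym d u v); exact: met_lipschitz.
Qed.

(** * Families indexed by a countable set *)

(** Transfers tolerances from a countable index set to the naturals, where the
    points of [separating_bumps] are constructed recursively. *)
Lemma pos_factor (K : Type) (code : K -> nat) (g : K -> R) :
  injective code -> (forall k, 0 < g k) ->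
  exists g' : nat -> R, (forall n, 0 < g' n) /\ forall k, g' (code k) = g k.
Proof.
move=> inj g0.
have /choice[g' g'P] : forall n, exists r, 0 < r /\
    forall k, code k = n -> r = g k.
  move=> n; have [[k <-]|nk] := pselect (exists k, code k = n).
    by exists (g k); split => // k' /inj ->.
  by exists 1; split => // k kn; case: nk; exists k.
by exists g'; split => [n|k]; [case: (g'P n)|case: (g'P (code k)) => _; exact].
Qed.

(** Below N there are finitely many indices, so one radius serves all of the
    corresponding Lipschitz constants. *)
Lemma small_radius (Q : Type) (code : Q -> nat) (C : Q -> R) (eps : R) :
  injective code -> 0 < eps -> forall N, exists2 r, 0 < r &
    forall q, (code q < N)%N -> C q * r <= eps.
Proof.
move=> inj eps0; elim=> [|N [r r0 rP]]; first by exists 1.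
have [[q0 q0N]|nq] := pselect (exists q, code q = N); last first.
  exists r => // q; rewrite ltnS leq_eqVlt => /orP[/eqP qN|/rP//].
  by case: nq; exists q.
have C1 : 0 < `|C q0| + 1 by have := normr_ge0 (C q0); lra.
exists (Num.min r (eps / (`|C q0| + 1))); first by rewrite lt_min r0 divr_gt0.
move=> q qN; have [Cq|Cq] := leP (C q) 0.
  by apply: le_trans (ltW eps0); rewrite mulr_le0_ge0// le_min !ltW// divr_gt0.
move: qN; rewrite ltnS leq_eqVlt => /orP[/eqP qN|/rP]; last first.
  by apply: le_trans; rewrite ler_pM2l// ge_min lexx.
have <- : q = q0 by apply: inj; rewrite q0N.
apply: (@le_trans _ _ (C q * (eps / (`|C q| + 1)))).
  by rewrite ler_pM2l// ge_min lexx orbT.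
rewrite mulrA ler_pdivrMr; last by have := normr_ge0 (C q); lra.
by rewrite mulrC ler_pM2l//; have := ler_norm (C q); lra.
Qed.

Lemma finite_met_lb (L : topologicalType) (dL : Met R L) (a : seq L) :
  exists2 delta, 0 < delta &
    {in a &, forall u v, u != v -> delta <= dL u v}.
Proof.
have lb (s : seq (L * L)) : exists2 delta, 0 < delta &
    forall w, w \in s -> w.1 != w.2 -> delta <= dL w.1 w.2.
  elim: s => [|w s [r r0 rP]]; first by exists 1.
  have [ww|ww] := eqVneq w.1 w.2.
    exists r => // w'; rewrite inE => /orP[/eqP->|/rP//].
    by rewrite ww eqxx.
  exists (Num.min r (dL w.1 w.2)).
    by rewrite lt_min r0 met_gt0//; exact/eqP.
  move=> w'; rewrite inE => /orP[/eqP->|/rP rw' /rw'].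
    by rewrite ge_min lexx orbT.
  by apply: le_trans; rewrite ge_min lexx.
have [r r0 rP] := lb [seq (u, v) | u <- a, v <- a].
by exists r => // u v ua va; apply: (rP (u, v)); apply/allpairsP; exists (u, v).
Qed.

(** * Realising countably many finite metric spaces at once *)

(** The sequence [a q] enumerates [L q].  The hypothesis on [dL] lets the
    spaces shrink along the enumeration of the indices: this is needed because
    all the copies accumulate at the same point p. *)
Lemma simultaneous_isometries (X : topologicalType) (d : Met R X) (p : X)
    (Q : Type) (code : Q -> nat) (L : Q -> topologicalType)
    (dL : forall q, Met R (L q)) (a : forall q, seq (L q)) (c : R) :
  (forall r, 0 < r -> exists y, 0 < d p y < r) ->
  injective code -> 0 < c ->
  (forall q, uniq (a q)) -> (forall q (u : L q), u \in a q) ->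
  (forall q u v, dL q u v <= c / (code q).+1%:R) ->
  exists2 e : Met R X, (dist_Met d e <= c%:E)%E &
    forall q, exists i : L q -> X, forall u v, e (i u) (i v) = dL q u v.
Proof.
move=> acc inj c0 ua aP diam.
have /choice[del delP] : forall q, exists delta, 0 < delta /\
    forall u v : L q, u <> v -> delta <= dL q u v.
  move=> q; have [r r0 rP] := finite_met_lb (dL q) (a q).
  by exists r; split => // u v /eqP; apply: rP; exact: aP.
(* The number j stands for the j-th point of [a q]; only finitely many of the
   points [x (idx (q, j))] are used for each q, the rest being spare. *)
pose idx (qj : Q * nat) := choice.pickle (code qj.1, qj.2).
have idx_inj : injective idx.
  move=> [q j] [q' j'] qq; by case: (pcan_inj choice.pickleK qq) => /inj -> ->.
have [s [s0 sP]] : exists s : nat -> R, (forall n, 0 < s n) /\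
    forall qj, s (idx qj) = del qj.1 / 2.
  by apply: pos_factor => // qj; rewrite divr_gt0//; case: (delP qj.1).
have [x [h [C [xs h0 hx hC]]]] := separating_bumps acc s0.
pose k q (u : L q) := idx (q, index u (a q)).
have kq q q' (u : L q) (v : L q') : k q u = k q' v -> q = q'.
  by move/idx_inj => -[].
have kinj q : injective (k q).
  move=> u v /idx_inj[uv].
  by have := congr1 (nth u (a q)) uv; rewrite !nth_index ?aP.
pose i q u := x (k q u).
have d_dL q u v : d (i q u) (i q v) <= dL q u v.
  have [->|uv] := pselect (u = v); first by rewrite !met_xx.
  have [_ /(_ _ _ uv)] := delP q; apply: le_trans.
  apply: le_trans (met_triangle d _ p _) _; rewrite (met_sym d _ p).
  by have := xs (k q u); have := xs (k q v); rewrite !sP /i /=; lra.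
pose b q := c / (code q).+1%:R.
have b0 q : 0 <= b q by rewrite divr_ge0// ltW.
(* The truncation at [b q] leaves the values on the copies unchanged, by the
   bound on [dL], and keeps f small where supports of bumps could overlap. *)
pose f q (l : L q) y :=
  Num.min (b q) (\sum_(m <- a q) dL q l m * h (k q m) y).
have f_own q (l u : L q) : f q l (i q u) = dL q l u.
  rewrite /f (bigD1_seq u)//= hx eqxx mulr1 big1 ?addr0.
    by apply/min_idPr; exact: diam.
  move=> m mu; rewrite hx; case: eqP => [/kinj um|_]; last by rewrite mulr0.
  by rewrite um eqxx in mu.
have f_other q q' (l : L q) (u : L q') : q <> q' -> f q l (i q' u) = 0.
  move=> qq'; rewrite /f big1 ?(min_idPr _)// => m _.
  by rewrite hx; case: eqP => [/kq qq|]; [case: qq'|rewrite mulr0].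
have f_bound q l y : 0 <= f q l y <= b q.
  rewrite /f ge_min lexx le_min b0 /= andbT.
  by apply: sumr_ge0 => m _; rewrite mulr_ge0// met_ge0.
have f_osc q l y z : `|f q l y - f q l z| <= b q.
  have /andP[? ?] := f_bound q l y; have /andP[? ?] := f_bound q l z.
  by rewrite ler_norml; lra.
pose C' q := \sum_(m <- a q) b q * C (k q m).
have f_lip q l y z : `|f q l y - f q l z| <= C' q * d y z.
  apply: le_trans (min_lipschitz _ _ _) _.
  rewrite -sumrB mulr_suml; apply: le_trans (ler_norm_sum _ _ _) _.
  apply: ler_sum => m _; rewrite -mulrBr normrM ger0_norm ?met_ge0// -mulrA.
  by rewrite ler_pM// met_ge0.
pose Phi := [set g : X -> R | exists q l, g = f q l].
have b_le q : b q <= c.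
  by rewrite ler_pdivrMr// ler_peMr ?ler1n// ltW.
have Phic g : Phi g -> forall y z, `|g y - g z| <= c.
  by move=> [q [l ->]] y z; apply: le_trans (b_le q).
(* For [code q >= N] the height [b q] of f is already below eps; the remaining
   indices are handled by their Lipschitz constants. *)
have equi y eps : 0 < eps -> exists2 r, 0 < r &
    forall g, Phi g -> forall z, d y z < r -> `|g y - g z| <= eps.
  move=> eps0; have [N] : exists N : nat, c / eps < N.+1%:R.
    exists (Num.truncn (c / eps)); exact: truncnS_gt.
  rewrite ltr_pdivrMr// => cN.
  have [r r0 rP] := small_radius C' inj eps0 N.
  exists r => // _ [q [l ->]] z yz.
  have [qN|Nq] := ltnP (code q) N.
    apply: le_trans (f_lip q l y z) _; have [C0|C0] := leP (C' q) 0.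
      by apply: le_trans (ltW eps0); rewrite mulr_le0_ge0// met_ge0.
    by apply: le_trans (rP q qN); rewrite ler_pM2l// ltW.
  apply: le_trans (f_osc q l y z) _; rewrite ler_pdivrMr//.
  by apply: le_trans (ltW cN) _; rewrite mulrC ler_pM2l// ler_nat.
have [e [de f_e e_le]] := sup_perturbation (ltW c0) Phic equi.
exists e => // q; exists (i q) => u v.
  apply/eqP; rewrite eq_le; apply/andP; split.
  apply: e_le => // _ [q' [l ->]].
  have [qq|qq] := pselect (q' = q); last first.
    by rewrite !f_other// subrr normr0 met_ge0.
  by subst q'; rewrite !f_own; exact: met_lipschitz.
(* Frechet's observation: the function of index [u] attains the distance. *)
have := f_e (f q u) _ (i q u) (i q v).
rewrite !f_own met_xx sub0r normrN ger0_norm ?met_ge0//.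
by apply; exists q, u.
Qed.

(** * The two halves of the theorem *)

Lemma anti_transmissible_Gdelta (G : transmissible_parameter R)
    (X : topologicalType) :
  Gdelta [set d : Met R X | anti_transmissible_property G d].
Proof.
have [code code_inj] := countable_injP _ (tp_Q_countable G).
have inj : injective code by move=> q q'; apply: code_inj; rewrite inE.
(* For n outside the range of [code] this set is the whole space. *)
exists (fun n => [set d : Met R X | forall q, code q = n ->
    exists (a : Seq (tp_G q) X) (z : tp_Z G), ~ tp_F q (tp_phi a z d)]).
  move=> n; have [[q qn]|nq] := pselect (exists q, code q = n); last first.
    rewrite (_ : [set _ | _] = setT); first exact: openT.
    by apply/seteqP; split => // d _ q qn; case: nq; exists q.
  rewrite (_ : [set _ | _] = \bigcup_(az in [set: Seq (tp_G q) X * tp_Z G])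
     ((fun d : Met R X => tp_phi az.1 az.2 d) @^-1` (~` tp_F q))); last first.
    apply/seteqP; split=> [d /(_ q qn)[a [z nF]]|d [[a z] _ nF] q' q'n].
      by exists (a, z).
    by have -> : q' = q by [apply: inj; rewrite q'n]; exists a, z.
  apply: bigcup_open => -[a z] _; apply: open_comp => [d _|].
    exact: tp_TP1.
  by apply: closed_openC; exact: tp_F_closed.
apply/seteqP; split=> d /=.
  move=> anti n _ q _; apply: contrapT => /forallNP H; apply: anti.
  exists q => a z; apply: contrapT => nF.
  by apply: (H a); exists z.
move=> H [q qP]; have [a [z]] := H (code q) I q erefl; apply; exact: qP.
Qed.

Lemma anti_transmissible_approx (G : transmissible_parameter R)
    (X : topologicalType) (d : Met R X) (c : R) :
  singular G -> ~ discrete_space X -> 0 < c ->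
  exists2 e : Met R X, (dist_Met d e <= c%:E)%E &
    anti_transmissible_property G e.
Proof.
move=> sing nondisc c0.
have [code code_inj] := countable_injP _ (tp_Q_countable G).
have inj : injective code by move=> q q'; apply: code_inj; rewrite inE.
have [p acc] := nonisolated_point d nondisc.
(* The sequence of points is stored without its type [Seq (tp_G q) _], which
   depends on q: this makes the choice of witnesses non-dependent. *)
pose bad q (w : {L : topologicalType & Met R L * seq L}%type) :=
  exists (z : tp_Z G) (a : Seq (tp_G q) (projT1 w)),
  [/\ seq_val a = (projT2 w).2, forall u, u \in (projT2 w).2,
     forall u v, (projT2 w).1 u v <= c / (code q).+1%:R &
     ~ tp_F q (tp_phi a z (projT2 w).1)].
have /choice[w wP] : forall q, exists w, bad q w.
  move=> q; have eps0 : 0 < c / (code q).+1%:R by rewrite divr_gt0.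
  have [z [L [dL [fL diam _ [a sa nF]]]]] := sing q _ eps0.
  exists (existT _ L (dL, seq_val a)), z, a; split => // [u|u v] /=.
    (* An injective sequence of length card(L) exhausts L. *)
    have asub : {subset seq_val a <= fset_set [set: L]}.
      by move=> v _; rewrite in_fset_set// inE.
    have [|_ ->] := uniq_min_size (seq_uniq a) asub; first by rewrite sa.
    by rewrite in_fset_set// inE.
  rewrite -lee_fin; apply: le_trans diam.
  by apply: ereal_sup_ubound; exists (u, v).
have [|||e de ei] := @simultaneous_isometries X d p _ code
  (fun q => projT1 (w q)) (fun q => (projT2 (w q)).1)
  (fun q => (projT2 (w q)).2) c acc inj c0.
- by move=> q; have [z [a [<- _ _ _]]] := wP q; exact: seq_uniq.
- by move=> q; have [z [a []]] := wP q.
- by move=> q; have [z [a []]] := wP q.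
exists e => // -[q qP]; have [z [a [_ _ _]]] := wP q; apply.
have [i iE] := ei q; have [j [_ <-]] := isometry_embedding iE.
by rewrite -tp_TP2; exact: qP.
Qed.

End Perturbation.

Theorem theorem1p2 (R : realType) (G : transmissible_parameter R)
    (hG : singular G) (X : topologicalType) (hX : metrizable R X)
    (hX' : ~ discrete_space X) :
  dense [set d : Met R X | anti_transmissible_property G d] /\
  Gdelta [set d : Met R X | anti_transmissible_property G d].
Proof.
split; last exact: anti_transmissible_Gdelta.
move=> O [d Od] oO.
have /nbhs_ballP[r /= r0 rO] : nbhs d O by exact: open_nbhs_nbhs.
have r20 : 0 < r / 2 by rewrite divr_gt0.
have [e de anti] := anti_transmissible_approx d hG hX' r20.
exists e; split => //; apply: rO; rewrite /ball /= /ball_Met /=.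
by apply: le_lt_trans de _; rewrite lte_fin; lra.
Qed.
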